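(* Let $\mathcal{A}$ be a commutative unital associative complex algebra. Then $\Omega^1_Z(\mathcal{A})$ identifies canonically with the module of Kähler differentials $\Omega^1_{\mathcal{A}\vert\mathbb{C}}$, and $d_Z$ identifies with the corresponding universal derivation; that is, there is a canonical isomorphism of $\mathcal{A}$-modules $\Omega^1_Z(\mathcal{A})\cong\Omega^1_{\mathcal{A}\vert\mathbb{C}}$ carrying $d_Z$ to the universal derivation $\mathcal{A}\to\Omega^1_{\mathcal{A}\vert\mathbb{C}}$.
   Context: For a unital associative complex algebra $\mathcal{A}$ with center $Z(\mathcal{A})$, let $\Omega^1_u(\mathcal{A})\subset\mathcal{A}\otimes_{\mathbb{C}}\mathcal{A}$ be the kernel of the product map $x\otimes y\mapsto xy$, regarded as an $(\mathcal{A},\mathcal{A})$-bimodule, and let $d_u:\mathcal{A}\to\Omega^1_u(\mathcal{A})$ be the derivation $d_u(x)=1\otimes x-x\otimes 1$. Let $[Z(\mathcal{A}),\Omega^1_u(\mathcal{A})]$ be the subbimodule spanned by the elements $z\omega-\omega z$ with $z\in Z(\mathcal{A})$, $\omega\in\Omega^1_u(\mathcal{A})$. Set $\Omega^1_Z(\mathcal{A})=\Omega^1_u(\mathcal{A})/[Z(\mathcal{A}),\Omega^1_u(\mathcal{A})]$, with canonical projection $p_Z$, and $d_Z=p_Z\circ d_u$. When $\mathcal{A}$ is commutative, $Z(\mathcal{A})=\mathcal{A}$ and left and right actions of $\mathcal{A}$ on $\Omega^1_Z(\mathcal{A})$ coincide, so $\Omega^1_Z(\mathcal{A})$ is an $\mathcal{A}$-module.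 *)

(* Defs.v *)
From HB Require Import structures.
From mathcomp Require Import all_boot all_algebra.
From mathcomp Require Import boolp classical_sets reals.
From mathcomp Require Import complex finmap monalg.

Set Implicit Arguments.
Unset Strict Implicit.
Unset Printing Implicit Defensive.

Import GRing.Theory.

Local Open Scope classical_set_scope.
Local Open Scope ring_scope.
Local Open Scope quotient_scope.

(* A unital algebra as a ring with a central scalar map.  Unlike the library's
   [algType], this includes the zero algebra. *)
HB.mixin Record isPzAlgebra (k : comPzRingType) A of GRing.PzRing A := {
  scalar_map : k -> A;
  scalar_map_zmod : zmod_morphism scalar_map;
  scalar_map_monoid : monoid_morphism scalar_map;
  scalar_map_central : forall c x, GRing.comm (scalar_map c) x
}.

#[short(type="pzAlgType")]
HB.structure Definition PzAlgebra (k : comPzRingType) :=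
  {A of isPzAlgebra k A & GRing.PzRing A}.

#[short(type="comPzAlgType")]
HB.structure Definition ComPzAlgebra (k : comPzRingType) :=
  {A of PzAlgebra k A & GRing.ComPzRing A}.

HB.instance Definition _ (k : comPzRingType) (A : pzAlgType k) :=
  GRing.isZmodMorphism.Build k A (@scalar_map k A) scalar_map_zmod.
HB.instance Definition _ (k : comPzRingType) (A : pzAlgType k) :=
  GRing.isMonoidMorphism.Build k A (@scalar_map k A) scalar_map_monoid.

Section AlgTypeInstances.
Variables (k : comPzRingType).

Lemma in_alg_central (A : algType k) (c : k) (x : A) : GRing.comm c%:A x.
Proof. by rewrite /GRing.comm -scalerAl mul1r -scalerAr mulr1. Qed.

Lemma in_alg_monoid (A : algType k) : monoid_morphism (in_alg A).
Proof. by split; [exact: rmorph1 | exact: rmorphM]. Qed.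

Definition pzAlg_of_alg (A : algType k) : pzAlgType k :=
  HB.pack (GRing.Algebra.sort A) (isPzAlgebra.Build k (GRing.Algebra.sort A)
    (raddfB (in_alg A)) (in_alg_monoid A) (@in_alg_central A)).

Definition comPzAlg_of_comAlg (A : comAlgType k) : comPzAlgType k :=
  HB.pack (GRing.ComAlgebra.sort A) (isPzAlgebra.Build k
    (GRing.ComAlgebra.sort A)
    (raddfB (in_alg A)) (in_alg_monoid A) (@in_alg_central A)).

End AlgTypeInstances.

(* [A] with its [k]-module structure; convertible to [A]. *)
Definition kmod (k : comPzRingType) (A : pzAlgType k) : Type := A.

Section KModule.
Variables (k : comPzRingType) (A : pzAlgType k).

HB.instance Definition _ := GRing.Zmodule.on (kmod A).

Definition kmod_scale (c : k) (x : kmod A) : kmod A := scalar_map c * (x : A).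

Lemma kmod_scaleA a b x : kmod_scale a (kmod_scale b x) = kmod_scale (a * b) x.
Proof. by rewrite /kmod_scale mulrA rmorphM. Qed.
Lemma kmod_scale1 : left_id 1 kmod_scale.
Proof. by move=> x; rewrite /kmod_scale rmorph1 mul1r. Qed.
Lemma kmod_scaleDr : right_distributive kmod_scale +%R.
Proof. by move=> a x y; rewrite /kmod_scale mulrDr. Qed.
Lemma kmod_scaleDl x : {morph kmod_scale^~ x : a b / a + b}.
Proof. by move=> a b; rewrite /kmod_scale rmorphD mulrDl. Qed.

HB.instance Definition _ := GRing.Zmodule_isLmodule.Build k (kmod A)
  kmod_scaleA kmod_scale1 kmod_scaleDr kmod_scaleDl.

Lemma kmod_mull (y : A) : linear ((fun x : A => x * y) : kmod A -> kmod A).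
Proof. by move=> c u v; rewrite /GRing.scale /= /kmod_scale mulrDl mulrA. Qed.

Lemma kmod_mulr (x : A) : linear ((fun y : A => x * y) : kmod A -> kmod A).
Proof.
move=> c u v; rewrite /GRing.scale /= /kmod_scale mulrDr !mulrA.
by rewrite scalar_map_central.
Qed.

End KModule.

Definition center (A : pzRingType) : set A := [set z | forall x, GRing.comm z x].

(* [{malg K[X]}] is an lmodule in the library only when [K] is nontrivial. *)
Definition freemod (K : pzRingType) (X : choiceType) := {malg K[X]}.

Section FreeModule.
Variables (K : pzRingType) (X : choiceType).
Local Notation F := (freemod K X).

HB.instance Definition _ := GRing.Zmodule.on F.

Definition fm_scale (c : K) (g : F) : F :=
  \sum_(x <- msupp g) (<< c * g@_x *g x >> : {malg K[X]}).

Lemma fm_scaleE c g x : (fm_scale c g)@_x = c * g@_x.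
Proof.
rewrite {2}[g]monalgE !raddf_sum mulr_sumr.
by apply/eq_bigr=> /= i _; rewrite !mcoeffU mulrnAr.
Qed.

Lemma fm_scaleA c1 c2 g : fm_scale c1 (fm_scale c2 g) = fm_scale (c1 * c2) g.
Proof. by apply/malgP=> x; rewrite !fm_scaleE mulrA. Qed.

Lemma fm_scale1 : left_id 1 fm_scale.
Proof. by move=> g; apply/malgP=> x; rewrite fm_scaleE mul1r. Qed.

Lemma fm_scaleDr : right_distributive fm_scale +%R.
Proof.
by move=> c g h; apply/malgP=> x; rewrite !(mcoeffD, fm_scaleE) mulrDr.
Qed.

Lemma fm_scaleDl g : {morph fm_scale^~ g : a b / a + b}.
Proof.
by move=> a b; apply/malgP=> x; rewrite !(mcoeffD, fm_scaleE) mulrDl.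
Qed.

HB.instance Definition _ := GRing.Zmodule_isLmodule.Build K F
  fm_scaleA fm_scale1 fm_scaleDr fm_scaleDl.

Definition fm_gen (x : X) : F := (<< 1 *g x >> : {malg K[X]}).

Lemma fm_genE (g : F) : g = \sum_(x <- msupp g) g@_x *: fm_gen x.
Proof.
rewrite {1}[g]monalgE; apply: eq_bigr => x _; apply/malgP => y.
by rewrite fm_scaleE !mcoeffU mulrnAr mulr1.
Qed.

Lemma fm_coeff_lin x : scalable_for *%R (mcoeff x : F -> K).
Proof. by move=> c g; exact: fm_scaleE. Qed.

Definition fm_lift (M : lmodType K) (f : X -> M) (g : F) : M :=
  \sum_(x <- msupp g) g@_x *: f x.

Section Lift.
Variables (M : lmodType K) (f : X -> M).
Local Open Scope fset_scope.

Lemma fm_liftEw (d : {fset X}) (g : F) : msupp g `<=` d ->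
  fm_lift f g = \sum_(x <- d) g@_x *: f x.
Proof.
move=> le; rewrite /fm_lift (big_fset_incl _ le) // => x _ /mcoeff_outdom ->.
by rewrite scale0r.
Qed.

Lemma fm_lift_is_linear : linear (fm_lift f).
Proof.
move=> c g h; pose d := msupp g `|` msupp h `|` msupp (c *: g + h).
rewrite !(@fm_liftEw d) /d ?fsubsetUr //; last first.
- by rewrite -fsetUA fsubsetUl.
- by apply: fsubset_trans (fsubsetUl _ _); apply: fsubsetUr.
rewrite scaler_sumr -big_split; apply: eq_bigr => x _ /=.
by rewrite mcoeffD fm_coeff_lin scalerDl scalerA.
Qed.

HB.instance Definition _ := GRing.isLinear.Build K F M *:%R (fm_lift f)
  fm_lift_is_linear.

Lemma fm_lift_gen x : fm_lift f (fm_gen x) = f x.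
Proof.
rewrite (@fm_liftEw [fset x]); last exact: msuppU_le.
by rewrite big_seq_fset1 mcoeffUU scale1r.
Qed.

End Lift.
End FreeModule.

Definition linspan (K : pzRingType) (V : lmodType K) (S : set V) : {pred V} :=
  [pred v | `[< exists n (c : 'I_n -> K) (s : 'I_n -> V),
                  (forall i, S (s i)) /\ v = \sum_i c i *: s i >]].

Section Quotient.
Variables (K : pzRingType) (V : lmodType K) (S : set V).

Lemma linspan_submod_closed : submod_closed (linspan S).
Proof.
split=> [|a u v /asboolP[n [c [s [Ss ->]]]] /asboolP[m [d [t [St ->]]]]].
  apply/asboolP; exists 0%N, (fun=> 0), (fun=> 0).
  by split=> [[]|] //; rewrite big_ord0.
apply/asboolP; exists (n + m)%N.
exists (fun i => match split i with inl j => a * c j | inr j => d j end).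
exists (fun i => match split i with inl j => s j | inr j => t j end).
split=> [i|]; first by case: (split i).
rewrite big_split_ord scaler_sumr /=; congr (_ + _); apply: eq_bigr => i _.
  by rewrite -[lshift m i]/(unsplit (inl i)) unsplitK scalerA.
by rewrite -[rshift n i]/(unsplit (inr i)) unsplitK.
Qed.

HB.instance Definition _ :=
  GRing.isSubmodClosed.Build K V (linspan S) linspan_submod_closed.

Lemma linspan_gen v : S v -> v \in linspan S.
Proof.
move=> Sv; apply/asboolP; exists 1%N, (fun=> 1), (fun=> v); split=> //.
by rewrite big_ord_recl big_ord0 scale1r addr0.
Qed.

(* The quotient of [V] by the submodule spanned by [S]. *)
Definition lquot := Quotient.quot (linspan S).

HB.instance Definition _ := Choice.on lquot.
HB.instance Definition _ := GRing.Zmodule.on lquot.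

Definition lq_pi (v : V) : lquot := \pi_(Quotient.quot (linspan S)) v.

Lemma lq_pi_is_zmod_morphism : zmod_morphism lq_pi.
Proof. by move=> u v; rewrite /lq_pi raddfB. Qed.

HB.instance Definition _ := GRing.isZmodMorphism.Build V lquot lq_pi
  lq_pi_is_zmod_morphism.

Definition lq_repr (q : lquot) : V := repr (q : Quotient.quot (linspan S)).

Lemma lq_reprK : cancel lq_repr lq_pi.
Proof. by move=> q; rewrite /lq_pi reprK. Qed.

Lemma lq_eqP u v : lq_pi u = lq_pi v <-> u - v \in linspan S.
Proof.
by rewrite Quotient.idealrBE; split=> [e|/eqP //]; apply/eqP; exact: e.
Qed.

Definition lq_scale (c : K) (q : lquot) : lquot := lq_pi (c *: lq_repr q).

Lemma lq_scale_pi c v : lq_scale c (lq_pi v) = lq_pi (c *: v).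
Proof.
apply/lq_eqP; rewrite -scalerBr; apply: rpredZ.
by apply/lq_eqP; rewrite lq_reprK.
Qed.

Lemma lq_scaleA a b q : lq_scale a (lq_scale b q) = lq_scale (a * b) q.
Proof. by rewrite -[q]lq_reprK !lq_scale_pi scalerA. Qed.

Lemma lq_scale1 : left_id 1 lq_scale.
Proof. by move=> q; rewrite -[q]lq_reprK lq_scale_pi scale1r. Qed.

Lemma lq_scaleDr : right_distributive lq_scale +%R.
Proof.
move=> a p q; rewrite -[p]lq_reprK -[q]lq_reprK.
by rewrite -raddfD !lq_scale_pi scalerDr raddfD.
Qed.

Lemma lq_scaleDl q : {morph lq_scale^~ q : a b / a + b}.
Proof.
by move=> a b; rewrite -[q]lq_reprK !lq_scale_pi scalerDl raddfD.
Qed.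

HB.instance Definition _ := GRing.Zmodule_isLmodule.Build K lquot
  lq_scaleA lq_scale1 lq_scaleDr lq_scaleDl.

Lemma lq_pi_is_scalable : scalable lq_pi.
Proof. by move=> a v; rewrite -lq_scale_pi. Qed.

HB.instance Definition _ := GRing.isScalable.Build K V lquot *:%R lq_pi
  lq_pi_is_scalable.

Lemma lq_piP a u v : a *: lq_pi u + lq_pi v = lq_pi (a *: u + v).
Proof. by rewrite linearP. Qed.

Definition lq_lift (T : Type) (f : V -> T) (q : lquot) : T := f (lq_repr q).

Lemma lq_lift_pi (W : zmodType) (f : {additive V -> W}) :
  (forall v, v \in linspan S -> f v = 0) ->
  forall v, lq_lift f (lq_pi v) = f v.
Proof.
move=> f0 v; apply/eqP; rewrite -subr_eq0 -raddfB f0 //.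
by apply/lq_eqP; rewrite lq_reprK.
Qed.

Lemma linspan_ker (W : lmodType K) (f : {linear V -> W}) :
  (forall v, S v -> f v = 0) -> forall v, v \in linspan S -> f v = 0.
Proof.
move=> f0 v /asboolP[n [c [s [Ss ->]]]]; rewrite linear_sum big1 // => i _.
by rewrite linearZ /= f0 ?scaler0.
Qed.

Lemma lq_lift_linear (W : lmodType K) (f : {linear V -> W}) :
  (forall v, S v -> f v = 0) -> linear (lq_lift f).
Proof.
move=> /linspan_ker f0 a p q; rewrite -[p]lq_reprK -[q]lq_reprK.
by rewrite lq_piP !lq_lift_pi //; exact: linearP.
Qed.

End Quotient.

Section Tensor.
Variables (k : comPzRingType) (U V : lmodType k).
Local Notation gen u v := (fm_gen k (u, v)).

Definition bilinear_rel : set (freemod k (U * V)%type) :=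
  [set r | (exists c u u' v,
              r = gen (c *: u + u') v - (c *: gen u v + gen u' v))
        \/ (exists c u v v',
              r = gen u (c *: v + v') - (c *: gen u v + gen u v'))].

Definition tens := lquot bilinear_rel.

HB.instance Definition _ := GRing.Lmodule.on tens.

Definition tensor (u : U) (v : V) : tens := lq_pi bilinear_rel (gen u v).

Lemma tensorPl c u u' v :
  tensor (c *: u + u') v = c *: tensor u v + tensor u' v.
Proof.
rewrite /tensor lq_piP; apply/lq_eqP; apply: linspan_gen.
by left; exists c, u, u', v.
Qed.

Lemma tensorPr c u v v' :
  tensor u (c *: v + v') = c *: tensor u v + tensor u v'.
Proof.
rewrite /tensor lq_piP; apply/lq_eqP; apply: linspan_gen.
by right; exists c, u, v, v'.
Qed.

(* The map out of [U ⊗ V] induced by [f]; meaningful only for bilinear [f]. *)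
Definition tens_lift (M : lmodType k) (f : U -> V -> M) : tens -> M :=
  lq_lift (fm_lift (fun p : U * V => f p.1 p.2)).

Section Lift.
Variables (M : lmodType k) (f : U -> V -> M).
Hypothesis fl : forall v, linear (f^~ v).
Hypothesis fr : forall u, linear (f u).

Let f0 r : bilinear_rel r -> fm_lift (fun p : U * V => f p.1 p.2) r = 0.
Proof.
by case=> [[c [u [u' [v ->]]]]|[c [u [v [v' ->]]]]];
   rewrite linearB linearP /= !fm_lift_gen /= ?fl ?fr subrr.
Qed.

Lemma tens_lift_linear : linear (tens_lift f).
Proof. exact: lq_lift_linear f0. Qed.

Lemma tens_liftE u v : tens_lift f (tensor u v) = f u v.
Proof.
rewrite /tens_lift lq_lift_pi; first exact: fm_lift_gen.
exact: linspan_ker f0.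
Qed.

End Lift.

Lemma tens_ind (P : tens -> Prop) :
  P 0 -> (forall c u v t, P t -> P (c *: tensor u v + t)) -> forall t, P t.
Proof.
move=> P0 PD t; rewrite -[t]lq_reprK [lq_repr t]fm_genE linear_sum.
elim: (enum_fset _) => [|[u v] s IHs]; first by rewrite big_nil.
by rewrite big_cons linearZ; apply: PD.
Qed.

Lemma tens_eq (M : lmodType k) (f g : tens -> M) : linear f -> linear g ->
  (forall u v, f (tensor u v) = g (tensor u v)) -> f =1 g.
Proof.
move=> lf lg fg.
have h0 (h : tens -> M) : linear h -> h 0 = 0.
  by move=> lh; have := lh (-1) 0 0; rewrite scaler0 addr0 scaleN1r addNr.
elim/tens_ind => [|c u v t IHt]; first by rewrite !h0.
by rewrite lf lg fg IHt.
Qed.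

End Tensor.

Section OmegaU.
Variables (k : comPzRingType) (A : pzAlgType k).
Local Notation AA := (tens (kmod A) (kmod A)).

Definition tensA (x y : A) : AA := @tensor k (kmod A) (kmod A) x y.

Definition mul_tens : AA -> kmod A :=
  @tens_lift k (kmod A) (kmod A) (kmod A) (fun x y : A => x * y).
Definition lact (a : A) : AA -> AA :=
  @tens_lift k (kmod A) (kmod A) AA (fun x y : A => tensA (a * x) y).
Definition ract (a : A) : AA -> AA :=
  @tens_lift k (kmod A) (kmod A) AA (fun x y : A => tensA x (y * a)).

Let lactl (a y : A) : linear ((fun x : A => tensA (a * x) y) : kmod A -> AA).
Proof. by move=> c u v; rewrite kmod_mulr /tensA tensorPl. Qed.
Let lactr (a x : A) : linear ((fun y : A => tensA (a * x) y) : kmod A -> AA).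
Proof. by move=> c u v; rewrite /tensA tensorPr. Qed.
Let ractl (a y : A) : linear ((fun x : A => tensA x (y * a)) : kmod A -> AA).
Proof. by move=> c u v; rewrite /tensA tensorPl. Qed.
Let ractr (a x : A) : linear ((fun y : A => tensA x (y * a)) : kmod A -> AA).
Proof. by move=> c u v; rewrite kmod_mull /tensA tensorPr. Qed.

Lemma mul_tensE x y : mul_tens (tensA x y) = x * y.
Proof.
by apply: tens_liftE => [v|u]; [exact: kmod_mull | exact: kmod_mulr].
Qed.
Lemma lactE a x y : lact a (tensA x y) = tensA (a * x) y.
Proof. by apply: tens_liftE => [v|u]; [exact: lactl | exact: lactr]. Qed.
Lemma ractE a x y : ract a (tensA x y) = tensA x (y * a).
Proof. by apply: tens_liftE => [v|u]; [exact: ractl | exact: ractr]. Qed.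

Lemma tensA_eq (M : lmodType k) (f g : AA -> M) : linear f -> linear g ->
  (forall x y, f (tensA x y) = g (tensA x y)) -> f =1 g.
Proof. exact: tens_eq. Qed.

Lemma tensADl x x' y : tensA (x + x') y = tensA x y + tensA x' y.
Proof. by rewrite /tensA -[x in LHS](@scale1r k (kmod A)) tensorPl scale1r. Qed.

Lemma tensADr x y y' : tensA x (y + y') = tensA x y + tensA x y'.
Proof. by rewrite /tensA -[y in LHS](@scale1r k (kmod A)) tensorPr scale1r. Qed.

Lemma mul_tens_linear : linear mul_tens.
Proof.
by apply: tens_lift_linear => [v|u]; [exact: kmod_mull | exact: kmod_mulr].
Qed.
Lemma lact_linear a : linear (lact a).
Proof. by apply: tens_lift_linear => [v|u]; [exact: lactl | exact: lactr]. Qed.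
Lemma ract_linear a : linear (ract a).
Proof. by apply: tens_lift_linear => [v|u]; [exact: ractl | exact: ractr]. Qed.

HB.instance Definition _ := GRing.isLinear.Build k AA (kmod A) *:%R mul_tens
  mul_tens_linear.
HB.instance Definition _ a := GRing.isLinear.Build k AA AA *:%R (lact a)
  (lact_linear a).
HB.instance Definition _ a := GRing.isLinear.Build k AA AA *:%R (ract a)
  (ract_linear a).

Lemma lactA a b t : lact a (lact b t) = lact (a * b) t.
Proof.
apply: (tensA_eq (f := lact a \o lact b)) t; [exact: linearP|exact: linearP|].
by move=> x y /=; rewrite !lactE mulrA.
Qed.

Lemma lact1 t : lact 1 t = t.
Proof.
apply: (tensA_eq (f := lact 1) (g := idfun)) t; try exact: linearP.
by move=> x y /=; rewrite !lactE mul1r.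
Qed.

Lemma lactDl a b t : lact (a + b) t = lact a t + lact b t.
Proof.
apply: (tensA_eq (f := lact (a + b)) (g := lact a \+ lact b)) t;
  try exact: linearP.
by move=> x y /=; rewrite !lactE mulrDl tensADl.
Qed.

Lemma ractA a b t : ract b (ract a t) = ract (a * b) t.
Proof.
apply: (tensA_eq (f := ract b \o ract a)) t; try exact: linearP.
by move=> x y /=; rewrite !ractE mulrA.
Qed.

Lemma ract1 t : ract 1 t = t.
Proof.
apply: (tensA_eq (f := ract 1) (g := idfun)) t; try exact: linearP.
by move=> x y /=; rewrite !ractE mulr1.
Qed.

Lemma ractDl a b t : ract (a + b) t = ract a t + ract b t.
Proof.
apply: (tensA_eq (f := ract (a + b)) (g := ract a \+ ract b)) t;
  try exact: linearP.
by move=> x y /=; rewrite !ractE mulrDr tensADr.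
Qed.

Lemma lract a b t : lact a (ract b t) = ract b (lact a t).
Proof.
apply: (tensA_eq (f := lact a \o ract b) (g := ract b \o lact a)) t;
  try exact: linearP.
by move=> x y /=; rewrite !(ractE, lactE).
Qed.

Lemma mul_lact a t : mul_tens (lact a t) = a * (mul_tens t : A).
Proof.
apply: (tensA_eq (f := mul_tens \o lact a) (g := fun t => a * (mul_tens t : A))) t.
- exact: linearP.
- by move=> c u v /=; rewrite linearP kmod_mulr.
- by move=> x y /=; rewrite lactE !mul_tensE mulrA.
Qed.

Lemma mul_ract a t : mul_tens (ract a t) = (mul_tens t : A) * a.
Proof.
apply: (tensA_eq (f := mul_tens \o ract a) (g := fun t => (mul_tens t : A) * a)) t.
- exact: linearP.
- by move=> c u v /=; rewrite linearP kmod_mull.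
- by move=> x y /=; rewrite ractE !mul_tensE mulrA.
Qed.

Definition mul_ker : {pred AA} := [pred t | mul_tens t == 0].

Lemma mul_ker_zmod_closed : zmod_closed mul_ker.
Proof.
split=> [|s t /eqP s0 /eqP t0]; first by rewrite inE linear0.
by rewrite inE linearB /= s0 t0 subr0.
Qed.

HB.instance Definition _ := GRing.isZmodClosed.Build AA mul_ker
  mul_ker_zmod_closed.

Record omega_u := OmegaU { omega_u_val : AA; _ : omega_u_val \in mul_ker }.

HB.instance Definition _ := [isSub for omega_u_val].
HB.instance Definition _ := [Choice of omega_u by <:].
HB.instance Definition _ := [SubChoice_isSubZmodule of omega_u by <:].

Lemma lact_ker a (w : omega_u) : lact a (val w) \in mul_ker.
Proof. by case: w => t /= /eqP t0; rewrite inE mul_lact t0 mulr0. Qed.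

Lemma ract_ker a (w : omega_u) : ract a (val w) \in mul_ker.
Proof. by case: w => t /= /eqP t0; rewrite inE mul_ract t0 mul0r. Qed.

Definition omega_u_lact a w := OmegaU (lact_ker a w).
Definition omega_u_ract a w := OmegaU (ract_ker a w).

Lemma omega_u_lactA a b w :
  omega_u_lact a (omega_u_lact b w) = omega_u_lact (a * b) w.
Proof. by apply: val_inj; rewrite /= lactA. Qed.
Lemma omega_u_lact1 : left_id 1 omega_u_lact.
Proof. by move=> w; apply: val_inj; rewrite /= lact1. Qed.
Lemma omega_u_lactDr : right_distributive omega_u_lact +%R.
Proof. by move=> a v w; apply: val_inj; rewrite /= linearD. Qed.
Lemma omega_u_lactDl w : {morph omega_u_lact^~ w : a b / a + b}.
Proof. by move=> a b; apply: val_inj; rewrite /= lactDl. Qed.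

(* [a *: w] is the left action; the right action is [omega_u_ract]. *)
HB.instance Definition _ := GRing.Zmodule_isLmodule.Build A omega_u
  omega_u_lactA omega_u_lact1 omega_u_lactDr omega_u_lactDl.

Lemma omega_u_ract_linear a : linear (omega_u_ract a).
Proof. by move=> c v w; apply: val_inj; rewrite /= linearD lract. Qed.

HB.instance Definition _ a := GRing.isLinear.Build A omega_u omega_u *:%R
  (omega_u_ract a) (omega_u_ract_linear a).

Lemma du_ker (x : A) : tensA 1 x - tensA x 1 \in mul_ker.
Proof. by rewrite inE linearB /= !mul_tensE mul1r mulr1 subrr. Qed.

Definition du (x : A) : omega_u := OmegaU (du_ker x).

(* Left-linear combinations of these products [(z w - w z) b] form exactly the
   sub-bimodule spanned by the [z w - w z]. *)
Definition center_comm : set omega_u :=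
  [set v | exists z w b, center z /\
             v = omega_u_ract b (z *: w - omega_u_ract z w)].

Definition omega_Z := lquot center_comm.

HB.instance Definition _ := GRing.Lmodule.on omega_Z.

Definition p_Z : omega_u -> omega_Z := lq_pi center_comm.

HB.instance Definition _ := GRing.Linear.on p_Z.

Definition d_Z (x : A) : omega_Z := p_Z (du x).

Definition omega_Z_ract (a : A) : omega_Z -> omega_Z :=
  lq_lift (p_Z \o omega_u_ract a).

Lemma omega_Z_ractE a w : omega_Z_ract a (p_Z w) = p_Z (omega_u_ract a w).
Proof.
rewrite /omega_Z_ract lq_lift_pi // => v.
apply: linspan_ker => {}v [z [{}w [b [zC ->]]]] /=.
rewrite -[RHS](linear0 p_Z); apply/lq_eqP; rewrite subr0; apply: linspan_gen.
exists z, w, (b * a); split=> //.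
by apply: val_inj; rewrite /= ractA.
Qed.

End OmegaU.

Lemma omega_Z_ract_com (k : comPzRingType) (A : comPzAlgType k)
  (a : A) (w : omega_Z A) : omega_Z_ract a w = a *: w.
Proof.
rewrite -[w]lq_reprK -[lq_pi _ _]/(p_Z _) omega_Z_ractE -linearZ.
apply/esym/lq_eqP/linspan_gen; exists a, (lq_repr w), 1; split.
  by move=> x; exact: mulrC.
by apply: val_inj; rewrite /= ract1.
Qed.

Section Kaehler.
Variables (k : comPzRingType) (A : comPzAlgType k).
Local Notation δ x := (fm_gen A (x : A)).

Definition kaehler_rel : set (freemod A A) :=
  [set r | [\/ exists x y, r = δ (x + y) - (δ x + δ y),
               exists (c : k) x, r = δ (scalar_map c * x) - scalar_map c *: δ x
             | exists x y, r = δ (x * y) - (x *: δ y + y *: δ x)]].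

Definition kaehler := lquot kaehler_rel.

HB.instance Definition _ := GRing.Lmodule.on kaehler.

Definition d_kaehler (x : A) : kaehler := lq_pi kaehler_rel (δ x).

Definition is_derivation (M : lmodType A) (D : A -> M) :=
  [/\ forall x y, D (x + y) = D x + D y,
      forall (c : k) x, D (scalar_map c * x) = scalar_map c *: D x
    & forall x y, D (x * y) = x *: D y + y *: D x].

Lemma d_kaehler_derivation : is_derivation d_kaehler.
Proof.
split=> [x y|c x|x y]; rewrite /d_kaehler -?linearZ -?linearD;
  apply/lq_eqP/linspan_gen.
- by apply: Or31; exists x, y.
- by apply: Or32; exists c, x.
- by apply: Or33; exists x, y.
Qed.

Lemma d_kaehler_universal (M : lmodType A) (D : A -> M) : is_derivation D ->
  exists f : {linear kaehler -> M}, (forall x, f (d_kaehler x) = D x) /\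
    forall g : {linear kaehler -> M}, (forall x, g (d_kaehler x) = D x) ->
      g =1 f.
Proof.
case=> DD DZ DM; pose h : {linear freemod A A -> M} := fm_lift D.
have h0 r : kaehler_rel r -> h r = 0.
  case=> [[x [y ->]]|[c [x ->]]|[x [y ->]]]; rewrite /h linearB.
  - by rewrite linearD /= !fm_lift_gen DD subrr.
  - by rewrite linearZ /= !fm_lift_gen DZ subrr.
  - by rewrite linearD !linearZ /= !fm_lift_gen DM subrr.
pose H := GRing.isLinear.Build A kaehler M *:%R _ (lq_lift_linear h0).
pose f : {linear kaehler -> M} := HB.pack (lq_lift h : kaehler -> M) H.
have fE x : f (d_kaehler x) = D x.
  rewrite /= lq_lift_pi; first exact: fm_lift_gen.
  exact: linspan_ker h0.
exists f; split=> // g gE q.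
rewrite -[q]lq_reprK [lq_repr q]fm_genE !linear_sum; apply: eq_bigr => x _.
by rewrite !linearZ; congr (_ *: _); exact: etrans (gE x) (esym (fE x)).
Qed.

End Kaehler.

(* Main.v *)
Require Import Defs.
From HB Require Import structures.
From mathcomp Require Import all_boot all_algebra reals complex.
Import GRing.Theory.
Local Open Scope ring_scope.

(** The idea is that, for [A] commutative, [d_Z] is itself a universal
    derivation, so that [omega_Z A] and [kaehler A] represent the same functor.

    - [d_Z] is a derivation ([d_Z_derivation]).  In [omega_u] one only has the
      bimodule Leibniz rule [du (x y) = x du y + (du x) y]; dividing by the
      commutators with the center, which is all of [A], makes the right action
      equal to the left one.
    - Linear maps out of [omega_Z A] are determined by their values on the
      [d_Z x] ([omega_Z_ext]): modulo the tensors [a ⊗ 1] one has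
      [x ⊗ y = x (1 ⊗ y - y ⊗ 1)], and the [a] that remains at the end is the
      product of the tensor, which vanishes on [omega_u].
    - Every derivation [D] factors through [d_Z] ([omega_Z_lift]): the map
      [x ⊗ y |-> x D y] is only left linear on the whole tensor square, but it
      turns the right action into the left one on the kernel of the product
      ([derivation_tens_ract]), hence kills the commutators there.

    Applying the two universal properties to [d_kaehler] and [d_Z] gives linear
    maps in both directions; their composites fix the universal derivations, so
    they are identities. *)

(** The tensor square is a [k]-module, whereas the targets of derivations are
    [A]-modules; this copy of [M] carries the [k]-action needed to map out of
    the tensor square. *)
Definition restrict_scalars (k : comPzRingType) (A : pzAlgType k)
  (M : lmodType A) : Type := M.

Section RestrictScalars.
Variables (k : comPzRingType) (A : pzAlgType k) (M : lmodType A).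
Local Notation Mk := (restrict_scalars k A M).

HB.instance Definition _ := GRing.Zmodule.on Mk.

Definition restr_scale (c : k) (m : Mk) : Mk :=
  (scalar_map c : A) *: (m : M).

Lemma restr_scaleA a b m :
  restr_scale a (restr_scale b m) = restr_scale (a * b) m.
Proof. by rewrite /restr_scale scalerA rmorphM. Qed.
Lemma restr_scale1 : left_id 1 restr_scale.
Proof. by move=> m; rewrite /restr_scale rmorph1 scale1r. Qed.
Lemma restr_scaleDr : right_distributive restr_scale +%R.
Proof. by move=> a x y; rewrite /restr_scale scalerDr. Qed.
Lemma restr_scaleDl m : {morph restr_scale^~ m : a b / a + b}.
Proof. by move=> a b; rewrite /restr_scale rmorphD scalerDl. Qed.

HB.instance Definition _ := GRing.Zmodule_isLmodule.Build k Mk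
  restr_scaleA restr_scale1 restr_scaleDr restr_scaleDl.

Lemma restr_scaleE (c : k) (m : Mk) :
  c *: m = (scalar_map c : A) *: (m : M) :> M.
Proof. by []. Qed.

End RestrictScalars.

Section UniversalBimodule.
Variables (k : comPzRingType) (A : pzAlgType k).

Lemma tensA0l (y : A) : tensA 0 y = 0.
Proof. by apply: (addrI (tensA 0 y)); rewrite -tensADl !addr0. Qed.

Lemma tensA0r (x : A) : tensA x 0 = 0.
Proof. by apply: (addrI (tensA x 0)); rewrite -tensADr !addr0. Qed.

Lemma tensA_scalarl (c : k) (x y : A) :
  tensA (scalar_map c * x) y = c *: tensA x y.
Proof.
by rewrite -[_ * x]addr0 /tensA (@tensorPl k (kmod A)) -/(tensA 0 y)
           tensA0l addr0.
Qed.

Lemma tensA_scalarr (c : k) (x y : A) :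
  tensA x (scalar_map c * y) = c *: tensA x y.
Proof.
by rewrite -[_ * y]addr0 /tensA (@tensorPr k _ (kmod A)) -/(tensA x 0)
           tensA0r addr0.
Qed.

Lemma lact_scalar (c : k) (t : tens (kmod A) (kmod A)) :
  lact (scalar_map c : A) t = c *: t.
Proof.
apply: (tensA_eq (f := lact (scalar_map c : A)) (g := fun t => c *: t)) t.
- exact: linearP.
- by move=> b u v; rewrite scalerDr !scalerA mulrC.
by move=> x y; rewrite lactE tensA_scalarl.
Qed.

Lemma duD (x y : A) : du (x + y) = du x + du y.
Proof. by apply: val_inj; rewrite /= tensADl tensADr opprD addrACA. Qed.

Lemma du_scalar (c : k) (x : A) :
  du (scalar_map c * x) = (scalar_map c : A) *: du x.
Proof.
by apply: val_inj; rewrite /= lact_scalar tensA_scalarl tensA_scalarr scalerBr.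
Qed.

Lemma du_leibniz (x y : A) :
  du (x * y) = x *: du y + omega_u_ract y (du x).
Proof.
apply: val_inj; rewrite /= !linearB /= !(lactE, ractE) !(mul1r, mulr1).
by rewrite [RHS]addrC addrA subrK.
Qed.

Lemma omega_u_mul0 (w : omega_u A) : mul_tens (val w) = 0.
Proof. by case: w => t /= /eqP. Qed.

(** The differentials [du x] generate [omega_u A] as a left module, for
    [x ⊗ y - x y ⊗ 1 = x (1 ⊗ y - y ⊗ 1)]: the tensor [t - mul_tens t ⊗ 1],
    which is [t] itself when [t] is in the kernel of the product, is a left
    combination of them. *)
Lemma omega_u_ext (M : lmodType A) (f g : {linear omega_u A -> M}) :
  (forall x, f (du x) = g (du x)) -> f =1 g.
Proof.
move=> fg.
have fgt (t : tens (kmod A) (kmod A)) : exists w : omega_u A,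
    val w = t - tensA (mul_tens t : A) 1 /\ f w = g w.
  elim/tens_ind: t => [|c x y t [w [wE fgw]]].
    by exists 0; split; rewrite ?linear0 // tensA0l subr0.
  exists ((scalar_map c : A) *: (x *: du y) + w); split; last first.
    by rewrite !linearD !linearZ /= fg fgw.
  rewrite /= wE linearB /= !lactE mulr1 linearB /= !lact_scalar.
  (* [c] acts on [kmod A] as multiplication by [scalar_map c]. *)
  have -> : mul_tens (c *: tensA x y + t) = scalar_map c * (x * y) + mul_tens t.
    by rewrite linearP /= mul_tensE.
  by rewrite tensADl tensA_scalarl opprD addrACA.
move=> w; have [w' [w'E fgw']] := fgt (val w).
rewrite omega_u_mul0 tensA0l subr0 in w'E.
by rewrite -(val_inj w'E).
Qed.

Lemma omega_Z_ext (M : lmodType A) (f g : {linear omega_Z A -> M}) :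
  (forall x, f (d_Z x) = g (d_Z x)) -> f =1 g.
Proof.
move=> fg q; rewrite -[q]lq_reprK.
exact: (omega_u_ext _ (f \o @p_Z k A) (g \o @p_Z k A)).
Qed.

End UniversalBimodule.

Section CommutativeCase.
Variables (k : comPzRingType) (A : comPzAlgType k).
Local Notation AA := (tens (kmod A) (kmod A)).

Lemma d_Z_derivation : is_derivation (@d_Z k A).
Proof.
split=> [x y|c x|x y]; rewrite /d_Z.
- by rewrite duD linearD.
- by rewrite du_scalar linearZ.
- by rewrite du_leibniz linearD linearZ /= -omega_Z_ractE omega_Z_ract_com.
Qed.

Section Lift.
Variables (M : lmodType A) (D : A -> M).
Hypothesis derD : is_derivation D.

Definition derivation_tens : AA -> restrict_scalars k A M :=
  @tens_lift k (kmod A) (kmod A) (restrict_scalars k A M)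
    (fun x y : A => x *: D y).

Let mull (y : A) :
  linear ((fun x : A => x *: D y) : kmod A -> restrict_scalars k A M).
Proof. by move=> c u v; rewrite restr_scaleE scalerDl scalerA. Qed.

Let mulr (x : A) :
  linear ((fun y : A => x *: D y) : kmod A -> restrict_scalars k A M).
Proof.
case: derD => DD DZ _ c u v.
by rewrite restr_scaleE DD DZ scalerDr !scalerA [x * _]mulrC.
Qed.

Lemma derivation_tens_linear : linear derivation_tens.
Proof. exact: tens_lift_linear. Qed.

HB.instance Definition _ := GRing.isLinear.Build k AA (restrict_scalars k A M)
  *:%R derivation_tens derivation_tens_linear.

Lemma derivation_tensE (x y : A) : derivation_tens (tensA x y) = x *: D y.
Proof. exact: tens_liftE. Qed.

Lemma derivation_tens_lact (a : A) t :
  derivation_tens (lact a t) = a *: (derivation_tens t : M).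
Proof.
apply: (tensA_eq (M := restrict_scalars k A M) (f := derivation_tens \o lact a)
  (g := fun t => a *: (derivation_tens t : M))) t.
- exact: linearP.
- move=> c u v /=; rewrite linearP !restr_scaleE scalerDr !scalerA.
  by rewrite [a * _]mulrC.
- by move=> x y /=; rewrite lactE !derivation_tensE scalerA.
Qed.

(** By the Leibniz rule [x D (y a) = (x y) D a + a (x D y)], so the defect of
    right linearity is governed by the product of the tensor. *)
Lemma derivation_tens_ract (a : A) t :
  derivation_tens (ract a t) =
    (mul_tens t : A) *: D a + a *: (derivation_tens t : M).
Proof.
apply: (tensA_eq (M := restrict_scalars k A M) (f := derivation_tens \o ract a)
  (g := fun t => (mul_tens t : A) *: D a + a *: (derivation_tens t : M))) t.
- exact: linearP.
- move=> c u v /=; rewrite !linearP /= !restr_scaleE.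
  by rewrite [X in X *: D a]/GRing.add /= scalerDl !scalerDr !scalerA addrACA.
- case: derD => _ _ DM x y /=.
  rewrite ractE mul_tensE !derivation_tensE DM scalerDr !scalerA.
  by rewrite [x * a]mulrC.
Qed.

Definition derivation_omega_u (w : omega_u A) : M := derivation_tens (val w).

Lemma derivation_omega_u_linear : linear derivation_omega_u.
Proof.
move=> a u v; rewrite /derivation_omega_u /= linearD /=.
by rewrite derivation_tens_lact.
Qed.

HB.instance Definition _ := GRing.isLinear.Build A (omega_u A) M *:%R
  derivation_omega_u derivation_omega_u_linear.

Lemma derivation_omega_u_ract a w :
  derivation_omega_u (omega_u_ract a w) = a *: derivation_omega_u w.
Proof.
rewrite /derivation_omega_u /= derivation_tens_ract.
by rewrite omega_u_mul0 scale0r add0r.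
Qed.

(** On [omega_u A], [x ⊗ y |-> x D y] is linear on both sides for the same
    [A]-action, hence sends [z w] and [w z] to the same element. *)
Lemma derivation_omega_u_comm v : center_comm v -> derivation_omega_u v = 0.
Proof.
case=> [z [w [b [_ ->]]]]; rewrite derivation_omega_u_ract linearB linearZ /=.
by rewrite derivation_omega_u_ract subrr scaler0.
Qed.

Lemma derivation_omega_u_du x : derivation_omega_u (du x) = D x.
Proof.
have D1 : D 1 = 0.
  case: derD => _ _ /(_ 1 1); rewrite mulr1 scale1r => D11.
  by apply: (addrI (D 1)); rewrite addr0 -D11.
by rewrite /derivation_omega_u /= linearB /= !derivation_tensE D1 scaler0 subr0
           scale1r.
Qed.

Lemma omega_Z_lift : exists f : {linear omega_Z A -> M},
  forall x, f (d_Z x) = D x.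
Proof.
pose H := GRing.isLinear.Build A (omega_Z A) M *:%R _
  (lq_lift_linear derivation_omega_u_comm).
pose f : {linear omega_Z A -> M} :=
  HB.pack (lq_lift derivation_omega_u : omega_Z A -> M) H.
exists f => x; rewrite /= lq_lift_pi; first exact: derivation_omega_u_du.
exact: linspan_ker derivation_omega_u_comm.
Qed.

End Lift.

(** The uniqueness half of the universal property of [d_kaehler]: [f] and [g]
    both factor the derivation [f \o d_kaehler]. *)
Lemma kaehler_ext (M : lmodType A) (f g : {linear kaehler A -> M}) :
  (forall x, f (d_kaehler x) = g (d_kaehler x)) -> f =1 g.
Proof.
move=> fg.
have der : is_derivation (fun x => f (d_kaehler x)).
  by case: (@d_kaehler_derivation k A) => DD DZ DM;
     split=> *; rewrite ?DD ?DZ ?DM ?linearD ?linearZ.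
have [h [_ hU]] := d_kaehler_universal der.
by move=> q; rewrite (hU f) ?(hU g).
Qed.

End CommutativeCase.

Theorem corollary1 (R : realType) (A : comPzAlgType R[i]) :
  exists phi : {linear omega_Z A -> kaehler A},
    [/\ bijective phi,
        forall x : A, phi (d_Z x) = d_kaehler x &
        forall psi : {linear omega_Z A -> kaehler A},
          (forall x : A, psi (d_Z x) = d_kaehler x) -> psi =1 phi].
Proof.
have [phi phiE] := omega_Z_lift _ _ _ _ (@d_kaehler_derivation _ A).
have [psi [psiE _]] := d_kaehler_universal (@d_Z_derivation _ A).
exists phi; split=> //; last first.
  by move=> g gE; apply: omega_Z_ext => x; rewrite gE phiE.
exists psi.
  by apply: (omega_Z_ext _ _ _ (psi \o phi) idfun) => x /=; rewrite phiE psiE.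
by apply: (kaehler_ext _ _ _ (phi \o psi) idfun) => x /=; rewrite psiE phiE.
Qed.
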